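(* Let $U$ be a countably infinite set and $\mathrm{G}$ a subgroup of $\mathfrak{S}(U)$ with $\mathfrak{rc}(\emptyset)\neq U$. Then for every finite subset $F$ of $U$ and every copy $C\in\overline{\mathrm{G}}[U]$ with $F\subseteq C$, there exists a strictly decreasing sequence $C=C_0\supsetneq C_1\supsetneq C_2\supsetneq\cdots$ of copies $C_i\in\overline{\mathrm{G}}[U]$ such that $\mathfrak{rc}(F)=\bigcap_{i\in\omega}C_i$.
   Context: $\overline{\mathrm{G}}$ is the closure of $\mathrm{G}$ in $U^U$ for the function topology (maps $f:U\to U$ such that every finite restriction of $f$ is a restriction of some $g\in\mathrm{G}$); copies are elements of $\overline{\mathrm{G}}[U]=\{f[U]\mid f\in\overline{\mathrm{G}}\}$. For $F\subseteq U$, $\mathrm{G}\langle F\rangle=\{g\in\mathrm{G}\mid g(x)=x\ \forall x\in F\}$. A type is a pair $\langle F\mid p\rangle$ with $F$ a finite subset of $U$ and $p\in U$; its typeset is $\mathrm{G}\langle F\mid p\rangle=\{g(p)\mid g\in\mathrm{G}\langle F\rangle\}$. $\mathfrak{R}_0$ is the set of types whose typeset is finite; for an ordinal $\alpha$, $\langle F\mid p\rangle\in\mathfrak{R}_\alpha$ if there is a finite $F'\supseteq F$ such that for every $q\in\mathrm{G}\langle F\mid p\rangle$ the type $\langle F'\mid q\rangle$ lies in $\mathfrak{R}_\beta$ for some $\beta<\alpha$. A type is ranked if it lies in some $\mathfrak{R}_\alpha$. For finite $F$, $\mathfrak{rc}(F)$ is the union of $F$ with all typesets of ranked types $\langle F\mid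 p\rangle$ (so $\mathfrak{rc}(\emptyset)$ is the union of the orbits $\mathrm{G}\langle\emptyset\mid p\rangle$ of $\mathrm{G}$ for which $\langle\emptyset\mid p\rangle$ is ranked). *)

(* Defs.v *)
From mathcomp Require Import all_boot.
From mathcomp Require Import mathcomp_extra boolp classical_sets functions.
From mathcomp Require Import cardinality wochoice.

Set Implicit Arguments.
Unset Strict Implicit.
Unset Printing Implicit Defensive.

Local Open Scope classical_set_scope.

Section Homogeneous.
Context {U : Type}.
Implicit Types (G : set (U -> U)) (F : set U) (p : U).

Definition perm_subgroup G : Prop :=
  [/\ forall g, G g -> bijective g,
      G id,
      forall g h, G g -> G h -> G (g \o h)
    & forall g h, G g -> cancel g h -> cancel h g -> G h].

(* Closure of G in U^U for pointwise convergence, U being discrete. *)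
Definition fun_closure G : set (U -> U) :=
  [set f : U -> U | forall A : set U, finite_set A ->
     exists2 g, G g & forall x, A x -> g x = f x].

Definition copies G : set (set U) := [set range f | f in fun_closure G].

Definition pw_stab G F : set (U -> U) :=
  [set g | G g /\ forall x, F x -> g x = x].

Definition typeset G F p : set U := [set g p | g in pw_stab G F].

(* An ordinal is represented by an element a of a well-order (W, le): it is
   the order type of the elements below a.  On a well-order, ~~ le a b says
   that b is strictly below a.  The predicate [rank_class G le a F p] says
   that F is finite and that the type <F | p> lies in R_a. *)
Inductive rank_class G (W : Type) (le : rel W) : W -> set U -> U -> Prop :=
| rank_class_zero (a : W) F p of
    (forall b, le a b) & finite_set F & finite_set (typeset G F p) :
    rank_class G le a F p
| rank_class_step (a : W) F p (F' : set U) of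
    finite_set F & finite_set F' & F `<=` F' &
    (forall q, typeset G F p q ->
       exists2 b : W, ~~ le a b & rank_class G le b F' q) :
    rank_class G le a F p.

(* The step clause never applies at the least element a = 0, because p always
   belongs to its own typeset when G is a group. *)

Definition ranked G F p : Prop :=
  exists (W : Type) (le : rel W) (a : W),
    well_order le /\ rank_class G le a F p.

Definition rc G F : set U :=
  F `|` \bigcup_(p in [set p | ranked G F p]) typeset G F p.

End Homogeneous.

(* Main.v *)
(** If [<F | p>] is unranked then for every finite [F'] containing [F] some [q]
    in its typeset has [<F' | q>] unranked.  Hence one builds permutations
    [g_n] in [G] together with points [q_n] such that [g_n q_n = p],
    [g_(n+1)] agrees with [g_n] on the first [n] points and on [F], and [q_n]
    is unranked over these points; the limit of the [g_n] lies in the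
    closure of [G], fixes [F] and omits [p].  Composing with [f], any unranked
    point over [F] can be dropped from a copy [range f] containing [F].
    Conversely, ranked typesets over [F] lie in every copy containing [F], by
    induction on the rank: any finite set is moved into the copy by an element
    of the stabiliser of [F].  Since [rc(0) <> U], every copy has unranked
    points, so the dropping can go on forever along an enumeration of [U]. *)

Require Import Defs.
From mathcomp Require Import all_boot.
From mathcomp Require Import mathcomp_extra boolp classical_sets functions.
From mathcomp Require Import cardinality wochoice.

Local Open Scope classical_set_scope.

(** * Well-orders and ordinal sums *)

Section WellOrders.

Lemma well_order_reflexive {T : Type} {R : rel T} : well_order R -> reflexive R.
Proof.
move=> Rwo x; have [|z [[/asboolP -> xmin] _]] := Rwo (fun y => `[< y = x >]).
  by exists x; apply/asboolP.
by apply: xmin; apply/asboolP.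
Qed.

(** Both elements are minima of the pair, and [well_order] makes minima unique. *)
Lemma well_order_antisymmetric {T : Type} {R : rel T} :
  well_order R -> antisymmetric R.
Proof.
move=> Rwo x y /andP[Rxy Ryx]; have Rxx := well_order_reflexive Rwo.
have [|z [_ zuniq]] := Rwo (fun t => `[< t = x \/ t = y >]).
  by exists x; apply/asboolP; left.
have <- : z = x.
  by apply: zuniq; split=> [|t /asboolP[]->]//; apply/asboolP; left.
by apply: zuniq; split=> [|t /asboolP[]->]//; apply/asboolP; right.
Qed.

Lemma well_order_unit : well_order (fun _ _ : unit => true).
Proof. by move=> A [[] A0]; exists tt; split=> // -[]. Qed.

Context {W : nat -> Type} (le : forall n, rel (W n)).

(** The ordinal sum of the [le n], with a top element [None] adjoined. *)
Definition lex_sum (u v : option {n & W n}) : bool :=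
  match u, v with
  | _, None => true
  | None, Some _ => false
  | Some u, Some v =>
      (tag u < tag v) ||
      (tag u == tag v) && le (tag u) (tagged u) (tagged_as u v)
  end.

Lemma lex_sum_same n (a b : W n) :
  lex_sum (Some (Tagged W a)) (Some (Tagged W b)) = le n a b.
Proof. by rewrite /= ltnn eqxx tagged_asE. Qed.

Lemma lex_sum_lt n m (a : W n) (b : W m) : n < m ->
  lex_sum (Some (Tagged W a)) (Some (Tagged W b)).
Proof. by move=> /= ->. Qed.

(** A minimum is sought in the first summand that meets the set; [None] serves only for a set
    without other elements. *)
Lemma well_order_lex_sum : (forall n, well_order (le n)) -> well_order lex_sum.
Proof.
move=> lewo; apply: antisymmetric_well_order.
  move=> [[n a]|] [[m b]|] //.
  have [nm|mn|nm] := ltngtP n m.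
  - by rewrite /= nm (ltnNge m n) (ltnW nm) (gtn_eqF nm).
  - by rewrite /= mn (ltnNge n m) (ltnW mn) (gtn_eqF mn).
  - case: _ / nm b => b; rewrite !lex_sum_same.
    by move=> /(well_order_antisymmetric (lewo n)) ->.
move=> A [u Au].
have [[n0 n0P]|nosome] :=
  pselect (exists n, exists a : W n, Some (Tagged W a) \in A); last first.
  exists None; split; last by case=> [[n a]|] // Ana; case: nosome; exists n, a.
  by case: u Au => [[n a]|] // Ana; case: nosome; exists n, a.
have exP : exists n, `[< exists a : W n, Some (Tagged W a) \in A >].
  by exists n0; apply/asboolP.
case: (ex_minnP exP) => n /asboolP[a Ana] nmin.
have [|z [[Az zmin] _]] := lewo n (fun a => Some (Tagged W a) \in A).
  by exists a.
exists (Some (Tagged W z)); split=> // -[[m b]|] // Amb.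
have: n <= m by apply: nmin; apply/asboolP; exists b.
rewrite leq_eqVlt => /predU1P[nm|nm]; last exact: lex_sum_lt.
by case: _ / nm b Amb => b Anb; rewrite lex_sum_same; apply: zmin.
Qed.

End WellOrders.

(** * Typesets and ranks *)

Section Ranks.
Context {U : Type} {G : set (U -> U)} (Ggrp : perm_subgroup G).
Implicit Types (F : set U) (p q : U).

Lemma perm_subgroupV g : G g -> exists h, [/\ G h, cancel g h & cancel h g].
Proof.
case: Ggrp => Gbij _ _ GV Gg; have [h gK hK] := Gbij _ Gg.
by exists h; split=> //; apply: GV gK hK.
Qed.

Lemma pw_stab_comp F g h : pw_stab G F g -> pw_stab G F h ->
  pw_stab G F (g \o h).
Proof.
case: Ggrp => _ _ GM _ [Gg gF] [Gh hF]; split; first exact: GM.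
by move=> x Fx /=; rewrite hF ?gF.
Qed.

Lemma pw_stabV F g : pw_stab G F g ->
  exists h, [/\ pw_stab G F h, cancel g h & cancel h g].
Proof.
move=> [Gg gF]; have [h [Gh gK hK]] := perm_subgroupV g Gg.
by exists h; split=> //; split=> // x Fx; rewrite -{1}(gF x Fx) gK.
Qed.

Lemma typeset_id F p : typeset G F p p.
Proof. by case: Ggrp => _ G1 _ _; exists id. Qed.

Lemma typeset_trans F p q r :
  typeset G F p q -> typeset G F q r -> typeset G F p r.
Proof.
by move=> [g sg <-] [h sh <-]; exists (h \o g) => //; apply: pw_stab_comp.
Qed.

Lemma typeset_mem F p : F p -> typeset G F p `<=` [set p].
Proof. by move=> Fp _ [g [_ gF] <-]; apply: gF. Qed.

(** Conjugation by [g] carries the stabiliser of [F] onto that of its image. *)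
Lemma typeset_image g F p : G g ->
  typeset G (g @` F) (g p) = g @` typeset G F p.
Proof.
move=> Gg; have [h [Gh gK hK]] := perm_subgroupV g Gg.
case: Ggrp => _ _ GM _; apply/seteqP; split.
- move=> _ [k [Gk kF] <-]; exists (h (k (g p))); last exact: hK.
  exists (h \o (k \o g)) => //; split; first by apply: (GM _ _ _ (GM _ _ _ _)).
  by move=> x Fx /=; rewrite kF ?gK //; exists x.
- move=> _ [_ [k [Gk kF] <-] <-]; exists (g \o (k \o h)); last by rewrite /= gK.
  split; first by apply: (GM _ _ _ (GM _ _ _ _)).
  by move=> _ [x Fx <-] /=; rewrite gK kF.
Qed.

(* The automatically generated principle has no induction hypothesis in the
   step case, where the recursive occurrence is under an [exists2]. *)
Lemma rank_class_nested_ind W (le : rel W) (P : W -> set U -> U -> Prop) :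
  (forall a F p, (forall b, le a b) -> finite_set F ->
    finite_set (typeset G F p) -> P a F p) ->
  (forall a F p F', finite_set F -> finite_set F' -> F `<=` F' ->
    (forall q, typeset G F p q -> exists2 b, ~~ le a b & P b F' q) ->
    P a F p) ->
  forall a F p, rank_class G le a F p -> P a F p.
Proof.
move=> P0 PS; fix IH 4 => a F p [{}a {}F {}p|{}a {}F {}p F' Ffin F'fin FF' rF'].
  exact: P0.
apply: (PS a F p F') => // q /rF'[b ab rb].
by exists b => //; apply: IH.
Qed.

Lemma rank_class_image W (le : rel W) a F p g : G g ->
  rank_class G le a F p -> rank_class G le a (g @` F) (g p).
Proof.
move=> Gg; move: a F p; apply: rank_class_nested_ind
  => [a F p amin Ffin Tfin|a F p F' Ffin F'fin FF' IH].
  apply: rank_class_zero => //; first exact: finite_image.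
  by rewrite typeset_image //; apply: finite_image.
apply: (rank_class_step (F' := g @` F')); try exact: finite_image.
  exact: image_subset.
by rewrite typeset_image // => _ [q /IH[b ab qb] <-]; exists b.
Qed.

Lemma ranked_image F p g : G g -> ranked G F p -> ranked G (g @` F) (g p).
Proof.
move=> Gg [W [le [a [lewo ra]]]]; exists W, le, a; split=> //.
exact: rank_class_image.
Qed.

Lemma ranked_typeset F p q : typeset G F p q -> ranked G F p -> ranked G F q.
Proof.
move=> [g [Gg gF] <-] /(ranked_image _ _ g Gg).
suff -> : g @` F = F by [].
apply/seteqP; split=> [_ [x Fx <-]|x Fx]; first by rewrite gF.
by exists x => //; rewrite gF.
Qed.

(** Above the least element, adding the whole typeset to [F] fixes each of its points, so that their
    new typesets are singletons, of rank zero. *)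
Lemma rank_class_finite W (le : rel W) a F p : well_order le ->
  finite_set F -> finite_set (typeset G F p) -> rank_class G le a F p.
Proof.
move=> lewo Ffin Tfin.
have [|z [[_ zmin] _]] := lewo predT; first by exists a.
have [az|/negP az] := pselect (le a z).
  apply: rank_class_zero => // b.
  by rewrite (well_order_antisymmetric lewo a z) ?az ?zmin.
have FTfin : finite_set (F `|` typeset G F p) by rewrite finite_setU.
apply: (rank_class_step Ffin FTfin) => [|q Tq]; first by left.
exists z => //; apply: rank_class_zero => //; first by move=> b; apply: zmin.
by apply: (@sub_finite_set _ _ [set q]) => //; apply: typeset_mem; right.
Qed.

Lemma ranked_finite F p : finite_set F -> finite_set (typeset G F p) ->
  ranked G F p.
Proof.
move=> Ffin Tfin; exists unit, (fun _ _ => true), tt.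
by split; [exact: well_order_unit|apply: rank_class_finite well_order_unit _ _].
Qed.

Lemma ranked_mem F p : finite_set F -> F p -> ranked G F p.
Proof.
move=> Ffin Fp; apply: ranked_finite => //.
by apply: (@sub_finite_set _ _ [set p]) => //; apply: typeset_mem.
Qed.

Lemma rc_ranked F : finite_set F -> rc G F = [set p | ranked G F p].
Proof.
move=> Ffin; apply/seteqP; split=> [p [|[q rq]]|p rp].
- exact: ranked_mem.
- by move=> /ranked_typeset; apply.
- by right; exists p => //; apply: typeset_id.
Qed.

(** The least element of a summand need not be least in the sum, so the base case goes through
    [rank_class_finite]. *)
Lemma rank_class_lex_sum (W : nat -> Type) (le : forall n, rel (W n)) n
    (a : W n) F p : (forall n, well_order (le n)) ->
  rank_class G (le n) a F p ->
  rank_class G (lex_sum le) (Some (Tagged W a)) F p.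
Proof.
move=> lewo; have sumwo := well_order_lex_sum le lewo.
move: a F p; apply: rank_class_nested_ind
  => [a F p _ Ffin Tfin|a F p F' Ffin F'fin FF' IH].
  exact: rank_class_finite.
apply: (rank_class_step Ffin F'fin FF') => q /IH[b ab rb].
by exists (Some (Tagged W b)) => //; rewrite lex_sum_same.
Qed.

(* The ordinals of the types [<F' | q>] are bounded by the top element of the
   ordered sum of the well-orders that represent them. *)
Lemma ranked_step F F' p : countable [set: U] ->
  finite_set F -> finite_set F' -> F `<=` F' ->
  (forall q, typeset G F p q -> ranked G F' q) -> ranked G F p.
Proof.
move=> /countable_injP[e einj] Ffin F'fin FF' rF'.
(* Countability turns the family of well-orders into a sequence: at most one [q] has code [n]. *)
have wit n : exists S : {W : Type & rel W}, well_order (projT2 S) /\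
    forall q, e q = n -> typeset G F p q ->
    exists a, rank_class G (projT2 S) a F' q.
  have [[q [en Tq]]|noq] := pselect (exists q, e q = n /\ typeset G F p q).
    have [W [le [a [lewo ra]]]] := rF' q Tq.
    exists (existT _ W le); split=> // q' en' _; exists a.
    by rewrite (einj q' q) ?inE // en.
  (* The one-point order is a filler for codes that no point of the typeset has. *)
  exists (existT (fun W => rel W) unit (fun _ _ => true)).
  split; first exact: well_order_unit.
  by move=> q en Tq; case: noq; exists q.
have [S SP] := choice wit.
pose le n := projT2 (S n); have lewo n : well_order (le n) by have [] := SP n.
exists (option {n & projT1 (S n)}), (lex_sum le), None.
split; first exact: well_order_lex_sum.
apply: (rank_class_step Ffin F'fin FF') => q Tq.
have [a ra] := (SP (e q)).2 q erefl Tq.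
exists (Some (Tagged (fun n => projT1 (S n)) a)) => //.
by apply: (@rank_class_lex_sum (fun n => projT1 (S n)) le).
Qed.

Lemma unranked_step F F' p : countable [set: U] ->
  finite_set F -> finite_set F' -> F `<=` F' -> ~ ranked G F p ->
  exists2 q, typeset G F p q & ~ ranked G F' q.
Proof.
move=> Ucount Ffin F'fin FF' nrp; apply: contrapT => noq; apply: nrp.
apply: ranked_step Ucount Ffin F'fin FF' _ => q Tq.
by apply: contrapT => nrq; apply: noq; exists q.
Qed.

(** * Copies contain ranked typesets *)

Lemma fun_closure_inj f : fun_closure G f -> injective f.
Proof.
move=> fG x y fxy; have [|g Gg gf] := fG [set x; y]; first exact: finite_set2.
have [h [_ gK _]] := perm_subgroupV g Gg.
by rewrite -(gK x) -(gK y) !gf ?fxy //; [right|left].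
Qed.

Lemma fun_closure_comp f g : fun_closure G f -> fun_closure G g ->
  fun_closure G (f \o g).
Proof.
case: Ggrp => _ _ GM _ fG gG A Afin.
have [h Gh hg] := gG A Afin.
have [k Gk kf] := fG (g @` A) (finite_image _ Afin).
exists (k \o h); first exact: GM.
by move=> x Ax /=; rewrite hg // kf //; exists x.
Qed.

Lemma sub_fun_closure g : G g -> fun_closure G g.
Proof. by move=> Gg A _; exists g. Qed.

Lemma copies_preimage g C : G g -> copies G C -> copies G (g @^-1` C).
Proof.
move=> Gg [f fG <-]; have [h [Gh gK hK]] := perm_subgroupV g Gg.
exists (h \o f); first exact: fun_closure_comp (sub_fun_closure h Gh) fG.
apply/seteqP; split=> [_ [x _ <-]|x [y _ fy]].
  by exists x => //=; rewrite hK.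
by exists y => //=; rewrite fy gK.
Qed.

Lemma fun_closure_pullback f F : fun_closure G f -> finite_set F ->
  F `<=` range f -> finite_set (f @^-1` F) /\ f @` (f @^-1` F) = F.
Proof.
move=> fG Ffin FC; split; first by apply: finite_preimage => // x y _ _;
  apply: fun_closure_inj.
apply/seteqP; split=> [|y Fy]; first exact: image_preimage_subset.
by have [x _ fx] := FC y Fy; exists x => //; rewrite /preimage /= fx.
Qed.

Lemma copies_absorb F F' C : copies G C -> finite_set F -> finite_set F' ->
  F `<=` C -> exists2 g, pw_stab G F g & F' `<=` g @^-1` C.
Proof.
move=> [f fG <-] Ffin F'fin FC.
have [F0fin F0E] := fun_closure_pullback f F fG Ffin FC.
have [g Gg gf] := fG _ F0fin.
have [h [Gh gK hK]] := perm_subgroupV g Gg.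
have [|k Gk kf] := fG (f @^-1` F `|` h @` F').
  by rewrite finite_setU; split=> //; apply: finite_image.
(* On [F] the inverse [h] undoes [f] and [k] redoes it; on the image of [F'] under [h], [k] follows
   [f] into the copy. *)
exists (k \o h); last first.
  move=> x F'x; rewrite /= kf; last by right; exists x.
  by exists (h x).
split; first by case: Ggrp => _ _ GM _; apply: GM.
rewrite -F0E => _ [x F0x <-] /=.
by rewrite -{1}(gf x F0x) gK kf //; left.
Qed.

Lemma ranked_sub_copies F p C : ranked G F p -> copies G C -> F `<=` C ->
  typeset G F p `<=` C.
Proof.
(* [C] is generalised because the step case uses the induction hypothesis for another copy, the
   preimage of [C] under [g], which contains [F']. *)
move=> [W [le [a [_ ra]]]]; move: a F p ra C.
apply: rank_class_nested_ind => [a F p _ Ffin Tfin|a F p F' Ffin F'fin FF' IH]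
    C Ccopy FC.
  (* The finite typeset is moved into [C] by an element that permutes it. *)
  have [g sg gTC] := copies_absorb F _ C Ccopy Ffin Tfin FC.
  have [h [sh _ hK]] := pw_stabV F g sg.
  move=> q Tq; rewrite -(hK q); apply: gTC.
  by apply: typeset_trans Tq _; exists h.
have [g sg gF'C] := copies_absorb F F' C Ccopy Ffin F'fin FC.
have [h [sh _ hK]] := pw_stabV F g sg.
move=> q Tq; rewrite -(hK q).
have Thq : typeset G F p (h q) by apply: typeset_trans Tq _; exists h.
have [b _] := IH _ Thq.
move=> /(_ (g @^-1` C) (copies_preimage _ _ sg.1 Ccopy) gF'C); apply.
exact: typeset_id.
Qed.

(** * Omitting unranked points *)

(** Only finitely many points matter: on [F] and [p], [f] agrees with an element of the group, whose
    action preserves ranks. *)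
Lemma ranked_fun_closure f F p : fun_closure G f -> finite_set F ->
  ranked G (f @` F) (f p) <-> ranked G F p.
Proof.
move=> fG Ffin; have [|g Gg gf] := fG (F `|` [set p]).
  by rewrite finite_setU; split=> //; apply: finite_set1.
have gfF : f @` F = g @` F by apply: eq_imagel => x Fx; rewrite gf //; left.
rewrite gfF -gf; last by right.
split=> [|/(ranked_image _ _ g Gg)//].
have [h [Gh gK _]] := perm_subgroupV g Gg.
move=> /(ranked_image _ _ h Gh); rewrite gK image_comp.
by rewrite (_ : h \o g = id) ?image_id //; apply/funext.
Qed.

(* The state [(n, g, q)] satisfies [g q = p] while [<E n | q>] is unranked; the
   successive [g] agree on [E n], so they converge. *)
Lemma unranked_omit F p : countable [set: U] -> finite_set F ->
  ~ ranked G F p ->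
  exists f, [/\ fun_closure G f, F `<=` range f & ~ range f p].
Proof.
move=> Ucount Ffin nrp; have /countable_injP[e einj] := Ucount.
case: (Ggrp) => _ G1 GM _.
pose E n := F `|` [set x | e x < n].
have Efin n : finite_set (E n).
  rewrite finite_setU; split=> //.
  apply: (@finite_preimage _ _ `I_n e); last exact: finite_II.
  by move=> x y _ _; apply: einj; rewrite inE.
have EE m n : m <= n -> E m `<=` E n.
  by move=> mn x [Fx|xm]; [left|right; apply: leq_trans mn].
pose inv (s : nat * ((U -> U) * U)) :=
  [/\ G s.2.1, s.2.1 s.2.2 = p & ~ ranked G (E s.1) s.2.2].
pose R (s t : {s | inv s}) := (sval t).1 = (sval s).1.+1 /\
  forall x, E (sval s).1 x -> (sval t).2.1 x = (sval s).2.1 x.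
have step s : {t | R s t}.
  apply: cid; case: s => -[n [g q]] [/= Gg gq nrq].
  have [q' [k sk kq] nrq'] :=
    unranked_step _ _ _ Ucount (Efin n) (Efin n.+1) (EE _ _ (leqnSn n)) nrq.
  have [h [sh kK _]] := pw_stabV _ _ sk.
  (* Composing with the inverse of [k] sends [q'] to [p] and changes nothing on [E n]. *)
  have tP : inv (n.+1, (g \o h, q')).
    by split=> //=; [apply: GM => //; case: sh|rewrite -kq kK].
  exists (exist _ _ tP); split=> //= x Ex.
  by case: sh => _ ->.
have s0P : inv (0, (id, p)).
  split=> //=; suff -> : E 0 = F by [].
  by apply/seteqP; split=> [x [|//]|x]; [|left].
have [s [s0 sR]] := dependent_choice step (exist _ _ s0P).
pose g n := (sval (s n)).2.1.
have sn n : (sval (s n)).1 = n.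
  by elim: n => [|n IH]; [rewrite s0|have [-> _] := sR n; rewrite IH].
have gE n x : E n x -> g n.+1 x = g n x.
  by move=> Ex; have [_] := sR n; rewrite sn; apply.
have gEle m n x : m <= n -> E m x -> g n x = g m x.
  move=> /subnK <- Ex; elim: (n - m) => [//|k IH].
  by rewrite addSn gE //; apply: EE (leq_addl k m) _ Ex.
(* At stage [(e x).+1] the point [x] has entered [E], so its value is final. *)
pose f x := g (e x).+1 x.
have Ex x : E (e x).+1 x by right => /=.
have fg n x : E n x -> f x = g n x.
  move=> Enx; rewrite /f.
  by have [le|/ltnW le] := leqP n (e x).+1; [|symmetry]; apply: gEle.
have gG n : G (g n) by have [] := svalP (s n).
exists f; split.
- move=> A Afin.
  suff [n An] : exists n, A `<=` E n.
    by exists (g n) => // x /An /fg.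
  have /finite_seqP[r rE] := finite_image e Afin.
  exists (\max_(i <- r) i).+1 => x Ax; right.
  apply: (leq_bigmax_seq (F := id) (e x)) => //.
  by have : (e @` A) (e x) by [exists x]; rewrite rE.
- move=> x Fx; exists x => //; rewrite (fg 0); last by left.
  by rewrite /g s0.
(* If [f x = p], injectivity makes [x] the unranked point of stage [(e x).+1]; but [x] lies in [E]
   at that stage, hence is ranked over it. *)
- move=> [x _ fxp]; have [_ gq] := svalP (s (e x).+1); rewrite sn; apply.
  apply: ranked_mem => //.
  have [h [_ gK _]] := perm_subgroupV _ (gG (e x).+1).
  by rewrite -(gK (sval _).2.2) /g gq -fxp /f gK.
Qed.

(** Inside a copy [range f], the omission is done in the domain, where pulling back along [f] keeps
    the point unranked. *)
Lemma copies_omit F p C : countable [set: U] -> finite_set F ->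
  copies G C -> F `<=` C -> ~ ranked G F p ->
  exists D, [/\ copies G D, F `<=` D, D `<=` C & ~ D p].
Proof.
move=> Ucount Ffin Ccopy FC nrp.
have [Cp|nCp] := pselect (C p); last by exists C; split.
move: Ccopy FC Cp => [f fG <-] FC [x _ fx].
have [F0fin F0E] := fun_closure_pullback f F fG Ffin FC.
have [|d [dG F0d dx]] := unranked_omit (f @^-1` F) x Ucount F0fin.
  by move/(ranked_fun_closure f _ x fG F0fin).2; rewrite F0E fx.
exists (range (f \o d)); split.
- by exists (f \o d) => //; apply: fun_closure_comp.
- rewrite -F0E => _ [y F0y <-]; have [z _ <-] := F0d y F0y; by exists z.
- by move=> _ [y _ <-]; exists (d y).
- move=> [y _]; rewrite -fx => /(fun_closure_inj f fG) dyx; apply: dx.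
  by exists y.
Qed.

(** Enlarging the empty set to the pullback of [F] leaves some unranked point, which [f] carries
    into the copy, still unranked. This keeps the descent strict. *)
Lemma copies_unranked F C : countable [set: U] -> rc G set0 <> [set: U] ->
  finite_set F -> copies G C -> F `<=` C -> exists2 p, C p & ~ ranked G F p.
Proof.
move=> Ucount rcU Ffin [f fG <-] FC.
have [F0fin F0E] := fun_closure_pullback f F fG Ffin FC.
have [p nrp] : exists p, ~ ranked G set0 p.
  apply: contrapT => nop; apply: rcU.
  rewrite rc_ranked; last exact: finite_set0.
  by apply/seteqP; split=> // p _; apply: contrapT => nrp; apply: nop; exists p.
have [q _ nrq] :=
  unranked_step _ _ p Ucount (finite_set0 U) F0fin (sub0set _) nrp.
exists (f q); first by exists q.
by rewrite -F0E => /(ranked_fun_closure f _ q fG F0fin).1.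
Qed.

End Ranks.

(** * The decreasing sequence *)

Theorem theorem8p3 (U : Type) (G : set (U -> U)) :
  countable [set: U] -> infinite_set [set: U] ->
  perm_subgroup G -> rc G set0 <> [set: U] ->
  forall F : set U, finite_set F ->
  forall C : set U, copies G C -> F `<=` C ->
  exists Cs : nat -> set U,
    [/\ Cs 0%N = C,
        forall i, copies G (Cs i),
        forall i, Cs i.+1 `<` Cs i
      & rc G F = \bigcap_i Cs i].
Proof.
move=> Ucount _ Ggrp rcU F Ffin C Ccopy FC.
have /countable_injP[e einj] := Ucount.
have omit := copies_omit Ggrp F _ _ Ucount Ffin.
pose inv (s : nat * set U) := copies G s.2 /\ F `<=` s.2.
(* Stage [n] settles the point of code [n]: it survives only if ranked over [F]. *)
pose R (s t : {s | inv s}) := [/\ (sval t).1 = (sval s).1.+1,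
  (sval t).2 `<` (sval s).2 &
  forall x, e x = (sval s).1 -> (sval t).2 x -> ranked G F x].
have step s : {t | R s t}.
  apply: cid; case: s => -[n D] [/= Dcopy FD].
  (* Dropping [p] makes the inclusion strict even when the point of code [n] is ranked or already
     absent. *)
  have [p Dp nrp] := copies_unranked Ggrp F D Ucount rcU Ffin Dcopy FD.
  have [D1 [D1copy FD1 D1D nD1p]] := omit p D Dcopy FD nrp.
  have D1ltD : D1 `<` D by split=> // /(_ p Dp).
  have [[x [ex nrx]]|nox] := pselect (exists x, e x = n /\ ~ ranked G F x).
    have [D2 [D2copy FD2 D2D1 nD2x]] := omit x D1 D1copy FD1 nrx.
    have tP : inv (n.+1, D2) by [].
    exists (exist _ _ tP); split=> //=; first split.
    - exact: subset_trans D2D1 D1D.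
    - by move=> DD2; apply: nD1p; apply: D2D1; apply: DD2.
    - by move=> y ey D2y; case: nD2x; rewrite (einj x y) ?inE // ex.
  have tP : inv (n.+1, D1) by [].
  exists (exist _ _ tP); split=> //= y ey _.
  by apply: contrapT => nry; apply: nox; exists y.
have s0P : inv (0%N, C) by [].
have [s [s0 sR]] := dependent_choice step (exist _ _ s0P).
have sn n : (sval (s n)).1 = n.
  by elim: n => [|n IH]; [rewrite s0|have [-> _ _] := sR n; rewrite IH].
exists (fun n => (sval (s n)).2); split.
- by rewrite s0.
- by move=> n; have [] := svalP (s n).
- by move=> n; have [] := sR n.
rewrite rc_ranked //; apply/seteqP; split=> [x rx n _|x sx].
  have [scopy Fs] := svalP (s n).
  exact: (ranked_sub_copies Ggrp F x _ rx scopy Fs _ (typeset_id Ggrp F x)).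
(* A point of all the copies has survived the stage that examines it. *)
have [_ _] := sR (e x); apply; first by rewrite sn.
exact: sx.
Qed.
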